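(* Let $G$ be a connected, planar graph associated to a link shadow $D$. Suppose that $G$ is the union of two subgraphs, $T_1$ and $T_2$, where $T_1$ and $T_2$ are edge-disjoint spanning trees for $G$. Then $G$ is a $\mathcal{P}$-position game for the Link Smoothing Game.
   Context: A link shadow $D$ is a connected link diagram in which under/over information is unspecified at the crossings (called precrossings). Link Smoothing Game on $D$: two players, $K$ (Knot) and $L$ (Link), alternately select a remaining precrossing and replace it by either of its two smoothings (horizontal or vertical), until no precrossings remain. The goal of $K$ is to keep the diagram connected; the goal of $L$ is to disconnect it (once disconnected, the diagram stays disconnected). Graph of a shadow: checkerboard color the regions of $D$; the (black) graph $G$ has one vertex per black region and one edge per precrossing, joining the black regions meeting there (loops and multiple edges allowed). The white graph is its planar dual $G^*$. Smoothing a precrossing amounts to either deleting the corresponding edge of $G$ (and contracting the dual edge in $G^*$) or contracting it in $G$ (and deleting the dual edge in $G^*$). The shadow is connected if and only if both graphs are connected. Thus the game can be played on $G$: players alternately choose a remaining edge and delete or contract it, and $L$ wins if either $G$ or $G^*$ becomes disconnected. The outcome class of $G$ means that of the corresponding shadow. $\mathcal{P}$-position means that the previous player (that is, the second player to move), whichever of $K$ and $L$ that is, can guarantee a win. *)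

(* Defs.v *)
From HB Require Import structures.
From mathcomp Require Import all_boot all_fingroup.

Set Implicit Arguments.
Unset Strict Implicit.
Unset Printing Implicit Defensive.

Import GroupScope.

(** * Finite multigraphs *)

(* [ends e] is the set of endpoints of [e]: one vertex if [e] is a loop, two
   otherwise. *)
Record mgraph := MGraph {
  vert : finType;
  edge : finType;
  ends : edge -> {set vert};
  ends_card : forall e, 0 < #|ends e| <= 2
}.

Section Multigraph.
Variable G : mgraph.
Implicit Types (T : {set edge G}) (c : seq (vert G * edge G)).

(* A spanning subgraph of [G] is given by its edge set [T]. *)

Definition adjacent T : rel (vert G) :=
  fun u v => [exists e in T, ends e == [set u; v]].

Definition gconnected T : Prop := forall u v, connect (adjacent T) u v.

(* [:: (v0, e0); ...; (vk, ek)] stands for v0 -e0- v1 - ... - vk -ek- v0.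
   A loop is a cycle of length 1, a pair of parallel edges one of length 2. *)
Definition gcycle T c : Prop :=
  [/\ c != [::],
      path.cycle (fun s t => ends s.2 == [set s.1; t.1]) c,
      uniq (unzip1 c), uniq (unzip2 c)
    & {subset unzip2 c <= T}].

Definition acyclic T : Prop := forall c, ~ gcycle T c.

Definition spanning_tree T : Prop := gconnected T /\ acyclic T.

End Multigraph.

(** * Link shadows *)

Section Maps.
Variables (dart : finType) (rot arc : {perm dart}).
Implicit Types (S : {set dart}) (x y : dart).

(* The darts are the ends of the arcs of a 4-valent plane graph: [rot] goes to
   the next dart counterclockwise around the same precrossing (so that the
   precrossings are the orbits of [rot]) and [arc] to the other end of the arc.
   The corner of a dart [x] is the one between [x] and [rot x]; it lies in the
   region to the left of [x] when leaving the precrossing, and [map_face x] is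
   the next dart, after [x], leaving a precrossing with that region on its left.
   Hence the regions are the orbits of [map_face]. *)
Definition map_face : {perm dart} := arc * rot^-1.

(* A partially smoothed shadow is described by the set [S] of the corners [x]
   cut off by a smoothing, that is, such that the strands [x] and [rot x] have
   been joined to each other; [x] and [rot (rot x)] are cut off together. *)
Definition map_remaining S x : bool := [disjoint porbit rot x & S].

Definition map_linked S : rel dart := fun x y =>
  (y == arc x) ||
  (if map_remaining S x then y \in porbit rot x
   else (x \in S) && (y == rot x) || (y \in S) && (x == rot y)).

Definition map_connected S : Prop := forall x y, connect (map_linked S) x y.

End Maps.

(* [planar] is Euler's formula (vertices + faces = edges + 2) for a connected
   map. It forces at least one precrossing: the circle without precrossing is
   not included (no move is possible on it, so that Knot wins there whoever is
   to move). *)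
Record shadow := Shadow {
  dart : finType;
  rot : {perm dart};
  arc : {perm dart};
  four_valent : forall x, #|porbit rot x| = 4;
  arc_involutive : involutive arc;
  arc_neq : forall x, arc x != x;
  shadow_connected : map_connected rot arc set0;
  planar : #|porbits rot| + #|porbits (map_face rot arc)|
           = #|porbits arc| + 2
}.

Definition face (D : shadow) : {perm dart D} := map_face (rot D) (arc D).

(* [x \in black] means that the region on the left of [x] is black; the two
   sides of an arc are the regions on the left of its two ends. *)
Record coloring (D : shadow) := Coloring {
  black :> {set dart D};
  black_face : forall x, (face D x \in black) = (x \in black);
  black_arc : forall x, (arc D x \in black) = (x \notin black)
}.

(** * The black graph of a shadow *)

Definition crossing (D : shadow) : finType :=
  {X : {set dart D} | X \in porbits (rot D)}.

Definition black_region (D : shadow) (B : coloring D) : finType :=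
  {F : {set dart D} | (F \in porbits (face D)) && (F \subset black B)}.

(* A crossing and a region have the dart [x] in common when the region contains
   the corner of [x], which is a corner of the crossing. *)
Definition black_ends (D : shadow) (B : coloring D) (X : crossing D) :
    {set black_region B} :=
  [set F : black_region B | val F :&: val X != set0].

Lemma black_rot (D : shadow) (B : coloring D) x :
  (rot D x \in black B) = (x \notin black B).
Proof.
have faceE : face D (arc D (rot D x)) = x.
  by rewrite /face /map_face permM arc_involutive permK.
by rewrite -{2}faceE black_face black_arc negbK.
Qed.

Lemma black_ends_card (D : shadow) (B : coloring D) (X : crossing D) :
  0 < #|black_ends B X| <= 2.
Proof.
case: X => X XP; have /imsetP[x0 _ defX] := XP.
have {x0 defX}[x xB defX] : exists2 x, x \in black B & X = porbit (rot D) x.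
  have [x0B|x0B] := boolP (x0 \in black B); first by exists x0.
  exists (rot D x0); first by rewrite black_rot.
  by rewrite -[rot D x0]/((rot D ^+ 1) x0) porbit_perm.
have regP y : y \in black B ->
    (porbit (face D) y \in porbits (face D)) &&
    (porbit (face D) y \subset black B).
  move=> yB; rewrite imset_f //=; apply/subsetP => _ /porbitP[i ->].
  elim: i => [|i IH]; first by rewrite perm1.
  by rewrite expgSr permM black_face.
pose reg y (yB : y \in black B) : black_region B := exist _ (porbit (face D) y) (regP y yB).
have xB2 : rot D (rot D x) \in black B by rewrite !black_rot negbK.
apply/andP; split.
  apply/card_gt0P; exists (reg x xB); rewrite inE /= defX.
  by apply/set0Pn; exists x; rewrite inE !porbit_id.
have le2 : #|[set reg x xB; reg _ xB2]| <= 2 by rewrite cards2; case: (_ != _).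
apply: leq_trans le2; apply: subset_leq_card.
apply/subsetP => -[F FP]; rewrite !inE /= => /set0Pn[y /setIP[yF yX]].
have /andP[/imsetP[z _ defF] /subsetP FB] := FP.
have defFy : F = porbit (face D) y.
  by rewrite defF; apply/eqP; rewrite eq_porbit_mem porbit_sym -defF.
have yB := FB y yF.
rewrite -!val_eqE /= defFy.
move: yX yB; rewrite defX porbit_traject four_valent /= !inE.
by case/or4P=> /eqP->; rewrite ?eqxx ?orbT // !black_rot xB.
Qed.

Definition black_graph (D : shadow) (B : coloring D) : mgraph :=
  MGraph (@black_ends_card D B).

(** * The Link Smoothing Game *)

Inductive player := Knot | Link.

Definition opponent (p : player) : player :=
  match p with Knot => Link | Link => Knot end.

(* Positions of the game are the sets of cut-off corners described above. *)
Section Game.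
Variable D : shadow.
Implicit Types (S : {set dart D}) (x : dart D) (p turn : player).

Definition remaining S x : bool := map_remaining (rot D) S x.

Definition diagram_connected S : Prop := map_connected (rot D) (arc D) S.

(* The smoothing of the precrossing of [x] that joins [x] to [rot x] and
   [rot (rot x)] to [rot (rot (rot x))]; the other one is [smooth S (rot x)]. *)
Definition smooth S x : {set dart D} := S :|: [set x; rot D (rot D x)].

Definition wins_at_end p S : Prop :=
  match p with
  | Knot => diagram_connected S
  | Link => ~ diagram_connected S
  end.

(* [can_win p turn S]: [p] can guarantee a win from [S] when [turn] is the
   player to move. *)
Inductive can_win p : player -> {set dart D} -> Prop :=
| can_win_end turn S :
    (forall x, ~~ remaining S x) -> wins_at_end p S -> can_win p turn S
| can_win_own S x :
    remaining S x -> can_win p (opponent p) (smooth S x) -> can_win p p S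
| can_win_opponent S :
    (exists x, remaining S x) ->
    (forall x, remaining S x -> can_win p p (smooth S x)) ->
    can_win p (opponent p) S.

End Game.

Definition P_position (D : shadow) : Prop :=
  forall second : player, can_win second (opponent second) (set0 : {set dart D}).

(* Main.v *)
From mathcomp Require Import all_boot all_fingroup zify.
Require Import Defs.

(* Let [n] be the number of black regions: there are [2n - 2] crossings, hence [n]
   white regions by Euler's formula. The final diagram is connected only if the
   contracted edges connect the black graph and the deleted ones connect the white
   graph, which takes [n - 1] edges each. So Link, moving second, answers every
   contraction by a deletion and conversely, except in the last round, where he
   copies Knot's move. Knot, moving second, keeps two bases [A1] and [A2] of the
   graphic matroid such that the contracted edges are [A1 :&: A2] and the remaining
   ones the symmetric difference: basis exchange provides the answers. In the end
   the contracted edges form a spanning tree, and contracting the edges of a forest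
   one by one merges two different loops each time. *)

Set Implicit Arguments.
Unset Strict Implicit.
Unset Printing Implicit Defensive.

Lemma card_imset_ker (T : finType) (R S : finType) (f : T -> R) (g : T -> S) :
  (forall x y, (f x == f y) = (g x == g y)) ->
  #|f @: [set: T]| = #|g @: [set: T]|.
Proof.
move=> fg.
have le (R' S' : finType) (f' : T -> R') (g' : T -> S') :
    (forall x y, (f' x == f' y) = (g' x == g' y)) ->
    #|f' @: [set: T]| <= #|g' @: [set: T]|.
  move=> fg'.
  (* [h] recovers [g' x] from [f' x]; singletons leave [set0] free as default. *)
  pose h r := if [pick x | f' x == r] is Some x then [set g' x] else set0.
  have hf x : h (f' x) = [set g' x].
    rewrite /h; case: pickP => [y|/(_ x)]; last by rewrite eqxx.
    by rewrite fg' => /eqP->.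
  rewrite -(@card_in_imset _ _ h) => [|_ _ /imsetP[x _ ->] /imsetP[y _ ->]].
    rewrite -(card_imset _ (@set1_inj S')); apply: subset_leq_card.
    apply/subsetP=> _ /imsetP[_ /imsetP[x _ ->] ->]; rewrite hf.
    by rewrite !imset_f ?inE.
  by rewrite !hf => /set1_inj/eqP; rewrite -fg' => /eqP.
by apply/eqP; rewrite eqn_leq !le.
Qed.

(** * The graphic matroid *)

Section Matroid.
Variable G : mgraph.
Implicit Types (X Y Z A : {set edge G}) (e f : edge G) (u v w : vert G).

Lemma adjacent_sym X : symmetric (adjacent X).
Proof. by move=> u v; rewrite /adjacent setUC. Qed.

Lemma adjacent_connect_sym X : connect_sym (adjacent X).
Proof. exact/sym_connect_sym/adjacent_sym. Qed.

Lemma connect_adjacentS X Y u v :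
  X \subset Y -> connect (adjacent X) u v -> connect (adjacent Y) u v.
Proof.
move=> /subsetP sXY; apply: connect_sub => a b /exists_inP[e eX ende].
by apply/connect1/exists_inP; exists e; rewrite ?sXY.
Qed.

Lemma connect_ends X e u v :
  e \in X -> ends e = [set u; v] -> connect (adjacent X) u v.
Proof. by move=> eX /eqP ende; apply/connect1/exists_inP; exists e. Qed.

Lemma endsP e : exists u v, ends e = [set u; v].
Proof.
case/andP: (ends_card e) => gt0 le2.
have [/eqP/cards1P[w ->]|ne1] := eqVneq #|ends e| 1.
  by exists w, w; rewrite setUid.
have /eqP/cards2P[a [b [_ ->]]] : #|ends e| = 2; last by exists a, b.
by apply/eqP; rewrite eqn_leq le2 ltn_neqAle eq_sym ne1.
Qed.

(** * Counting connected components *)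

Definition component X u : {set vert G} := [set v | connect (adjacent X) u v].

Definition ncomp X : nat := #|component X @: [set: vert G]|.

Lemma eq_component X u v :
  (component X u == component X v) = connect (adjacent X) u v.
Proof.
apply/eqP/idP => [/setP/(_ v)|uv]; first by rewrite !inE connect0.
apply/setP=> w; rewrite !inE.
exact: (same_connect (@adjacent_connect_sym X)).
Qed.

Lemma gconnectedP X : 0 < #|vert G| -> gconnected X <-> ncomp X = 1.
Proof.
move=> /card_gt0P[w _]; split=> [conX|/eqP/cards1P[c defc] u v].
  apply/eqP/cards1P; exists (component X w); apply/setP=> c; rewrite inE.
  apply/imsetP/eqP=> [[u _ ->]|->]; last by exists w; rewrite ?inE.
  by apply/eqP; rewrite eq_component.
have eqc x : component X x = c by apply/set1P; rewrite -defc imset_f ?inE.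
by rewrite -eq_component !eqc.
Qed.

Lemma ncomp0 : ncomp set0 = #|vert G|.
Proof.
rewrite /ncomp card_imset ?cardsT // => u v /eqP; rewrite eq_component.
case/connectP=> [[|w p]] /= => [_ ->//|/andP[/exists_inP[e]]].
by rewrite inE.
Qed.

Lemma ncompU1 X f u v : ends f = [set u; v] ->
  ncomp X = ncomp (f |: X) + ~~ connect (adjacent X) u v.
Proof.
move=> endf; set X' := f |: X.
have sXX' : X \subset X' := subsetUr _ _.
have uv' : connect (adjacent X') u v by apply: connect_ends endf; rewrite !inE eqxx.
(* Adding [f] merges the component of [v] into that of [u]. [k] has the kernel of [component X'],
   but its values are components of [X]: all of them, except that of [v] when the two differ. *)
pose k w := if connect (adjacent X) w v then component X u else component X w.
have kE a b : (component X' a == component X' b) = (k a == k b).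
  rewrite eq_component; apply/idP/eqP => [|kab].
    case/connectP=> p; elim: p a => [|c p IH] a /=; first by move=> _ ->.
    case/andP=> /exists_inP[g gX' /eqP endg] pp lastp.
    rewrite -(IH c pp lastp) {IH pp lastp}; case/setU1P: gX' => [gf|gX].
      have ku : k u = component X u by rewrite /k if_same.
      have kv : k v = component X u by rewrite /k connect0.
      have: a \in [set u; v] by rewrite -endf -gf endg !inE eqxx.
      have: c \in [set u; v] by rewrite -endf -gf endg !inE eqxx orbT.
      by rewrite !inE => /orP[]/eqP-> /orP[]/eqP->; rewrite ?ku ?kv.
    have ac := connect_ends gX endg.
    rewrite /k (same_connect (@adjacent_connect_sym X) ac).
    by rewrite (eqP (_ : component X a == component X c)) ?eq_component.
  have kc w : connect (adjacent X') w (if connect (adjacent X) w v then u else w).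
    case: ifP => [wv|_]; last exact: connect0.
    apply: connect_trans (connect_adjacentS sXX' wv) _.
    by rewrite adjacent_connect_sym.
  apply: connect_trans (kc a) _; rewrite adjacent_connect_sym.
  apply: connect_trans (kc b) _; apply: (connect_adjacentS sXX').
  by rewrite -eq_component -/(k _) eq_sym; move/eqP: kab; rewrite /k; do 2!case: ifP.
rewrite [ncomp X']/ncomp (card_imset_ker kE) /ncomp.
have [uv|nuv] := boolP (connect _ u v).
  rewrite addn0; congr #|pred_of_set _|; apply: eq_imset => w.
  rewrite /k; case: ifP => // wv; apply/eqP; rewrite eq_component.
  by apply: connect_trans wv _; rewrite adjacent_connect_sym.
rewrite (cardsD1 (component X v)) imset_f ?inE // addnC; congr (_ + _).
congr #|pred_of_set _|; apply/setP=> c; rewrite !inE.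
apply/andP/imsetP=> [[nc /imsetP[w _ cE]]|[w _ ->]].
  by exists w; rewrite ?inE // /k -eq_component -cE (negPf nc).
rewrite /k; case: ifPn => wv; first by rewrite eq_component imset_f ?inE.
by rewrite eq_component imset_f ?inE.
Qed.

Lemma ncompU1_le X f : ncomp (f |: X) <= ncomp X <= (ncomp (f |: X)).+1.
Proof.
have [u [v endf]] := endsP f; rewrite (ncompU1 X endf) leq_addr /=.
by rewrite -addn1 leq_add2l leq_b1.
Qed.


Lemma ncomp_le X Y : X \subset Y -> ncomp X <= ncomp Y + #|Y :\: X|.
Proof.
have [n] := ubnP #|Y :\: X|; elim: n X => // n IH X lt sXY.
have [/eqP|[e eYX]] := set_0Vmem (Y :\: X).
  rewrite setD_eq0 => sYX; have -> : X = Y by apply/eqP; rewrite eqEsubset sXY.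
  exact: leq_addr.
have cE : #|Y :\: X| = (#|Y :\: (e |: X)|).+1.
  by rewrite (cardsD1 e) eYX setDDl setUC.
case/setDP: eYX => eY eX.
rewrite cE addnS; have /andP[_] := ncompU1_le X e.
move/leq_trans; apply; rewrite ltnS; apply: IH.
  by rewrite -ltnS -cE.
by rewrite subUset sub1set eY.
Qed.

(** * Forests, bases and exchange *)

Lemma leq_vert_ncomp X : #|vert G| <= ncomp X + #|X|.
Proof. by rewrite -ncomp0 -{2}[X]setD0 ncomp_le ?sub0set. Qed.

(** The equality case of [leq_vert_ncomp]: each edge merges two components. Forests are the
    independent sets of the matroid. *)
Definition forest X : bool := ncomp X + #|X| == #|vert G|.

Lemma forestS X Y : X \subset Y -> forest Y -> forest X.
Proof.
move=> sXY /eqP fY; rewrite /forest eqn_leq leq_vert_ncomp andbT -fY.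
by rewrite -(cardsID X Y) (setIidPr sXY) addnCA addnC leq_add2l ncomp_le.
Qed.

Lemma forestU1 X f u v : f \notin X -> ends f = [set u; v] ->
  forest (f |: X) = forest X && ~~ connect (adjacent X) u v.
Proof.
move=> fX endf; have := leq_vert_ncomp X; rewrite /forest cardsU1 fX (ncompU1 X endf).
case: connect => /=; last by rewrite andbT addn1 addSnnS.
rewrite andbF addn0 addnCA add1n => le; apply/negbTE.
by rewrite neq_ltn ltnS le orbT.
Qed.

Definition basis A : bool := (ncomp A == 1) && (#|A|.+1 == #|vert G|).

Lemma basis_forest A : basis A -> forest A.
Proof. by case/andP=> /eqP cA /eqP vA; rewrite /forest cA add1n vA. Qed.

Lemma forest_basis A : forest A -> ncomp A = 1 -> basis A.
Proof. by rewrite /forest /basis => /eqP <- ->; rewrite eqxx add1n eqxx. Qed.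

Lemma basis_gconnected A : basis A -> gconnected A.
Proof.
by case/andP=> /eqP cA /eqP vA; apply/gconnectedP; rewrite // -vA.
Qed.

Lemma card_gconnected X : 0 < #|vert G| -> gconnected X -> #|vert G| <= #|X|.+1.
Proof.
by move=> G0 /(gconnectedP _ G0) cX; have := leq_vert_ncomp X; rewrite cX.
Qed.

(** A maximal forest between [X] and [X :|: A] connects the ends of every edge of [A], which could
    be added otherwise; it is connected because [A] is. *)
Lemma forest_augment X A : forest X -> basis A ->
  exists Z, [/\ basis Z, X \subset Z & Z \subset X :|: A].
Proof.
move=> fX bA; pose P Z := [&& forest Z, X \subset Z & Z \subset X :|: A].
have PX : P X by rewrite /P fX subxx subsetUl.
have [Z /maxsetP[/and3P[fZ sXZ sZ] maxZ] _] := maxset_exists PX.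
exists Z; split=> //; apply: forest_basis => //.
apply/gconnectedP; first by case/andP: bA => _ /eqP <-.
have sub : subrel (adjacent A) (connect (adjacent Z)).
  move=> u v /exists_inP[f fA /eqP endf]; apply/idPn=> nuv.
  have fZ' : f \notin Z by apply: contraNN nuv => fZ'; apply: connect_ends endf.
  move: (fZ'); rewrite -(maxZ (f |: Z)) ?setU11 ?subsetUr //.
  rewrite /P (forestU1 fZ' endf) fZ nuv (subset_trans sXZ) ?subsetUr //=.
  by rewrite subUset sZ andbT sub1set inE fA orbT.
by move=> u v; exact: connect_sub sub _ _ (basis_gconnected bA u v).
Qed.

(** The forest [e |: A1 :&: A2] extends within [e |: A2] to a basis [Z]. Being as large as [A2], [Z]
    misses a single [f], which is not in [A1] because [Z] contains [A1 :&: A2]. *)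
Lemma basis_exchangeU A1 A2 e : basis A1 -> basis A2 -> e \in A1 :\: A2 ->
  exists2 f, f \in A2 :\: A1 & basis (e |: A2 :\ f).
Proof.
move=> b1 b2 /setDP[e1 e2].
have [|Z [bZ sXZ sZ]] := @forest_augment (e |: A1 :&: A2) A2 _ b2.
  apply: forestS (basis_forest b1).
  by rewrite subUset sub1set e1 subsetIl.
have cE : #|A2| = #|Z|.
  by apply: succn_inj; case/andP: bZ b2 => _ /eqP-> /andP[_ /eqP].
have eZ : e \in Z by apply: (subsetP sXZ); rewrite !inE eqxx.
have sZ' : Z \subset e |: A2.
  by apply: subset_trans sZ _; rewrite -setUA (setUidPr (subsetIr _ _)).
have /cards1P[f defD] : #|(e |: A2) :\: Z| == 1.
  have := cardsID Z (e |: A2); rewrite (setIidPr sZ') cardsU1 e2 cE addnC.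
  by move/addIn->.
have /setDP[fA2 fZ] : f \in (e |: A2) :\: Z by rewrite defD set11.
have nfe : f != e by apply: contraNneq fZ => ->.
have {}fA2 : f \in A2 by move: fA2; rewrite !inE (negPf nfe).
exists f.
  rewrite inE fA2 andbT; apply: contraNN fZ => fA1.
  by apply: (subsetP sXZ); rewrite !inE fA1 fA2 orbT.
suff -> : e |: A2 :\ f = Z by [].
apply/setP=> g; have /setP/(_ g) := defD; have /subsetP/(_ g) := sZ'; rewrite !inE.
have [->|] := eqVneq g e; first by rewrite eZ.
case: (g \in Z) => /= [_ /(_ isT) ->|_ _ /=]; last by move=> ->; case: (g == f).
by move=> <-.
Qed.

(** Here [A1 :\ e] is extended by [A2]; the new basis has room for just one more element. *)
Lemma basis_exchangeD A1 A2 e : basis A1 -> basis A2 -> e \in A1 :\: A2 ->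
  exists2 f, f \in A2 :\: A1 & basis (f |: A1 :\ e).
Proof.
move=> b1 b2 /setDP[e1 e2].
have [|Z [bZ sXZ sZ]] := @forest_augment (A1 :\ e) A2 _ b2.
  exact: forestS (subD1set _ _) (basis_forest b1).
have cE : #|A1| = #|Z|.
  by apply: succn_inj; case/andP: bZ b1 => _ /eqP-> /andP[_ /eqP].
have /cards1P[f defD] : #|Z :\: (A1 :\ e)| == 1.
  have := cardsID (A1 :\ e) Z; rewrite (setIidPr sXZ) -cE (cardsD1 e A1) e1 addnC.
  by move/addIn->.
have /setDP[fZ fA1] : f \in Z :\: (A1 :\ e) by rewrite defD set11.
have fA2 : f \in A2 by have := subsetP sZ f fZ; rewrite inE (negPf fA1).
exists f.
  rewrite inE fA2 andbT; apply: contraNN fA1 => fA1.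
  by rewrite !inE fA1 andbT; apply: contraNneq e2 => <-.
suff -> : f |: A1 :\ e = Z by [].
apply/setP=> g; have /setP/(_ g) := defD; have /subsetP/(_ g) := sXZ; rewrite !inE.
case: (_ && _) => [->//|_ /=]; first by rewrite orbT.
by rewrite orbF => <-.
Qed.

(** * Cycles *)

(** [f] is a placeholder for the edge that will close a cycle. The last clause carries the
    induction: the edge leaving [u] is new, since the later edges have their ends among the later
    vertices. *)
Lemma walk_of_path X u p : path (adjacent X) u p -> uniq (u :: p) ->
  exists c : seq (vert G * edge G), forall f,
    [/\ sorted (fun s t => ends s.2 == [set s.1; t.1]) (rcons c (last u p, f)),
        rcons (unzip1 c) (last u p) = u :: p,
        uniq (unzip2 c), {subset unzip2 c <= X}
      & {in unzip2 c, forall e, ends e \subset u :: p}].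
Proof.
elim: p u => [|w p IH] u /=; first by exists [::] => f; split.
case/andP=> /exists_inP[e eX ende] pp /andP[up uwp].
have [c cP] := IH w pp uwp; exists ((u, e) :: c) => f.
have [path_c vert_c uniq_c sub_c end_c] := cP f.
split=> /=.
- case: (c) vert_c path_c => [|s c'] /= [-> _]; first by rewrite ende.
  by move->; rewrite ende.
- by rewrite vert_c.
- rewrite uniq_c andbT; apply: contraNN up => /end_c/subsetP; apply.
  by rewrite (eqP ende) !inE eqxx.
- by move=> g; rewrite inE => /predU1P[->|/sub_c].
- move=> g; rewrite inE => /predU1P[->|/end_c/subset_trans]; last first.
    by apply; apply/subsetP=> x xp; rewrite inE xp orbT.
  by rewrite (eqP ende); apply/subsetP=> x; rewrite !inE => /orP[]->; rewrite ?orbT.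
Qed.

Lemma acyclicU1 X f u v : f \notin X -> ends f = [set u; v] ->
  connect (adjacent X) u v -> ~ acyclic (f |: X).
Proof.
move=> fX endf /connectP[p0 pp0 ev]; move: endf; rewrite {v}ev.
case/shortenP: pp0 => p pp up _ endf.
have [c cP] := walk_of_path pp up; have [path_c vert_c uniq_c sub_c _] := cP f.
move/(_ (rcons c (last u p, f))); apply; split.
- by case: (c).
(* With the last entry rotated to the front, [path_c] covers everything but the step along [f] back
   to [u]. *)
- rewrite -(rotr_cycle 1) rotr1_rcons /=.
  case: (c) vert_c path_c => [|s c'] /= [eu _].
    by rewrite andbT endf eu.
  by rewrite endf -eu setUC eqxx.
- by rewrite /unzip1 map_rcons /= -/(unzip1 c) vert_c.
- rewrite /unzip2 map_rcons rcons_uniq /= -/(unzip2 c) uniq_c andbT.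
  by apply: contra fX => /sub_c.
move=> g; rewrite /unzip2 map_rcons mem_rcons inE => /predU1P[->|/sub_c gX].
  by rewrite !inE eqxx.
by rewrite !inE gX orbT.
Qed.

Lemma acyclic_forest X : acyclic X -> forest X.
Proof.
have [n] := ubnP #|X|; elim: n X => // n IH X lt acX.
have [->|[f fX]] := set_0Vmem X; first by rewrite /forest ncomp0 cards0 addn0.
have [u [v endf]] := endsP f.
have acX' : acyclic (X :\ f).
  by move=> c [? ? ? ? cX]; apply: (acX c); split=> // g /cX /setD1P[].
have nf : f \notin X :\ f by rewrite !inE eqxx.
rewrite -(setD1K fX) (forestU1 nf endf) IH //=; last by rewrite (cardsD1 f) fX in lt.
by apply/negP=> /(acyclicU1 nf endf); rewrite setD1K.
Qed.

Lemma spanning_tree_basis X : 0 < #|vert G| -> spanning_tree X -> basis X.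
Proof.
by move=> G0 [/(gconnectedP _ G0) cX /acyclic_forest fX]; apply: forest_basis.
Qed.

End Matroid.

(** * Loops and regions of a smoothed shadow *)

Section Shadow.
Variable D : shadow.
Implicit Types x y z : dart D.

Lemma rot4 x : rot D (rot D (rot D (rot D x))) = x.
Proof. by have := iter_porbit (rot D) x; rewrite four_valent. Qed.

Lemma mem_porbit_rot x y : (y \in porbit (rot D) x) =
  [|| y == x, y == rot D x, y == rot D (rot D x) | y == rot D (rot D (rot D x))].
Proof. by rewrite porbit_traject four_valent /= !inE. Qed.

Lemma face_arc x : face D (arc D x) = (rot D)^-1%g x.
Proof. by rewrite /face /map_face permM arc_involutive. Qed.

Lemma arcE x : arc D x = rot D (face D x).
Proof. by rewrite /face /map_face permM permKV. Qed.

Lemma cross_subproof x : porbit (rot D) x \in porbits (rot D).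
Proof. exact: imset_f. Qed.

Definition cross x : crossing D :=
  exist _ (porbit (rot D) x) (cross_subproof x).

Lemma eq_cross x y : (cross x == cross y) = (x \in porbit (rot D) y).
Proof. by rewrite -val_eqE /= eq_porbit_mem. Qed.

Lemma cross_rot x : cross (rot D x) = cross x.
Proof. by apply/eqP; rewrite eq_cross mem_porbit_rot eqxx orbT. Qed.

Lemma crossP (e : crossing D) : exists x, cross x = e.
Proof.
case: e => X XP; have /imsetP[x _ defX] := XP.
by exists x; apply: val_inj.
Qed.

(** [I] is to hold whenever the first player is to move. A reply must be shown to exist, so each
    invariant has to deal with parity. The game ends because the set of uncut corners shrinks. *)
Lemma second_wins p (I : {set dart D} -> Prop) :
  (forall S, I S -> (forall x, ~~ remaining S x) -> wins_at_end p S) ->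
  (forall S x, I S -> remaining S x ->
     exists2 y, remaining (smooth S x) y & I (smooth (smooth S x) y)) ->
  forall S, I S -> can_win p (opponent p) S.
Proof.
move=> Iend Istep S; have [n] := ubnP #|~: S|; elim: n S => // n IH S lt IS.
have [/existsP|] := boolP [exists x, remaining S x]; last first.
  rewrite negb_exists => /forallP end_S.
  by apply: can_win_end => //; apply: Iend.
move=> rem; apply: can_win_opponent => // x xS.
have [y yS Iy] := Istep S x IS xS; apply: (can_win_own yS); apply: IH => //.
have sub : ~: smooth (smooth S x) y \subset ~: smooth S x.
  by rewrite setCS subsetUl.
apply: leq_trans (_ : #|~: S| <= n) => //; apply: proper_card.
apply: (sub_proper_trans sub); rewrite properE setCS subsetUl setCS.
apply/subsetPn; exists x; first by rewrite !inE eqxx orbT.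
move: xS; rewrite /remaining /map_remaining disjoint_sym => /disjointFl-> //.
exact: porbit_id.
Qed.

(** * Counting darts, crossings and arcs *)

Lemma sum_card_porbits (s : {perm dart D}) :
  \sum_(F in porbits s) #|F| = #|dart D|.
Proof.
rewrite -[RHS]sum1_card (partition_big_imset (porbit s)) /=.
apply: eq_bigr => _ /imsetP[x _ ->]; rewrite -sum1_card; apply: eq_bigl => y.
by rewrite eq_porbit_mem.
Qed.

Lemma card_crossing_arcs : #|porbits (arc D)| = (#|crossing D|).*2.
Proof.
have cE : #|crossing D| = #|porbits (rot D)| by rewrite card_sig; apply: eq_card.
have rE : #|dart D| = #|porbits (rot D)| * 4.
  rewrite -(sum_card_porbits (rot D)) -sum_nat_const.
  by apply: eq_bigr => _ /imsetP[x _ ->]; rewrite four_valent.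
have aE : #|dart D| = #|porbits (arc D)| * 2.
  rewrite -(sum_card_porbits (arc D)) -sum_nat_const.
  apply: eq_bigr => _ /imsetP[x _ ->].
  have -> : porbit (arc D) x = [set x; arc D x].
    apply/setP=> y; rewrite !inE; apply/porbitP/orP=> [[i ->]|[]/eqP->].
    - elim: i => [|i]; first by rewrite perm1 eqxx; left.
      by rewrite expgSr permM => -[]/eqP->; rewrite ?arc_involutive eqxx; [right|left].
    - by exists 0; rewrite perm1.
    - by exists 1; rewrite expg1.
  by rewrite cards2 eq_sym arc_neq.
by rewrite cE; lia.
Qed.

(** Without crossings there are no darts, and Euler's formula would read [0 = 2]. *)
Lemma crossing_gt0 : 0 < #|crossing D|.
Proof.
case: (posnP #|crossing D|) => // c0.
have := planar D; rewrite card_crossing_arcs c0 /=.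
suff [-> ->] : #|porbits (rot D)| = 0 /\ #|porbits (map_face (rot D) (arc D))| = 0 by [].
have noD x : False by have := card0_eq c0 (cross x).
by split; apply: eq_card0 => F; apply/imsetP=> -[x].
Qed.

(** * The black graph in terms of darts *)

Section Colored.
Variable B : coloring D.
Local Notation GB := (black_graph B).

(** Its black graph is the white graph of [B], so results on black graphs also apply to the dual. *)
Definition recolor : coloring D.
Proof.
by exists (~: black B) => x; rewrite !inE ?black_face ?black_arc.
Defined.

(** Exactly one side of each arc is black; choosing it makes [region] total on darts and invariant
    under [arc]. *)
Definition blacken x : dart D := if x \in black B then x else arc D x.

Lemma region_subproof x :
  (porbit (face D) (blacken x) \in porbits (face D)) &&
  (porbit (face D) (blacken x) \subset black B).
Proof.
rewrite imset_f //=; apply/subsetP => _ /porbitP[i ->].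
elim: i => [|i IH]; last by rewrite expgSr permM black_face.
by rewrite perm1 /blacken; case: ifPn; rewrite ?black_arc.
Qed.

Definition region x : black_region B :=
  exist _ (porbit (face D) (blacken x)) (region_subproof x).

Lemma region_arc x : region (arc D x) = region x.
Proof.
apply: val_inj; rewrite /= /blacken black_arc.
by case: (x \in black B) => //=; rewrite arc_involutive.
Qed.

Lemma region_face x : x \in black B -> region (face D x) = region x.
Proof.
move=> xB; apply: val_inj; rewrite /= /blacken black_face xB.
by rewrite -[face D x]/((face D ^+ 1)%g x) porbit_perm.
Qed.

Lemma region_rot x : x \in black B -> region (rot D x) = region x.
Proof.
move=> xB; have xE : x = face D (arc D (rot D x)) by rewrite face_arc permK.
by rewrite {2}xE region_face ?region_arc // black_arc black_rot xB.
Qed.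

Lemma eq_region x y : x \in black B -> y \in black B ->
  (region x == region y) = (x \in porbit (face D) y).
Proof. by move=> xB yB; rewrite -val_eqE /= /blacken xB yB eq_porbit_mem. Qed.

Lemma regionP (F : black_region B) : exists2 x, x \in black B & region x = F.
Proof.
case: F => F FP; have /andP[/imsetP[x _ defF] /subsetP FB] := FP.
have xB : x \in black B by rewrite FB // defF porbit_id.
by exists x => //; apply: val_inj; rewrite /= /blacken xB.
Qed.

Lemma ends_cross x : x \in black B ->
  @ends GB (cross x) = [set region x; region (rot D (rot D x))].
Proof.
move=> xB; have xB2 : rot D (rot D x) \in black B by rewrite !black_rot negbK.
apply/setP=> F; have [y yB <-] := regionP F; rewrite !inE /= !eq_region //.
rewrite /blacken yB; apply/set0Pn/orP => [[z /setIP[zF]]|[]yx].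
- have zB : z \in black B.
    by have := region_subproof y; rewrite /blacken yB => /andP[_ /subsetP->].
  rewrite mem_porbit_rot => /or4P[]/eqP zE; rewrite ![y \in _]porbit_sym.
  + by left; rewrite -zE.
  + by move: zB; rewrite zE black_rot xB /=.
  + by right; rewrite -zE.
  + by move: zB; rewrite zE !black_rot xB /=.
- by exists x; rewrite inE porbit_id porbit_sym yx.
- by exists (rot D (rot D x)); rewrite inE porbit_sym yx mem_porbit_rot eqxx !orbT.
Qed.

(** Seen from a white corner, the ends are the black regions along the two strands that a
    contraction joins. *)
Lemma ends_cross_white x : x \notin black B ->
  @ends GB (cross x) = [set region x; region (rot D x)].
Proof.
move=> xB; set z := (rot D)^-1%g x; have zx : rot D z = x by rewrite permKV.
have zB : z \in black B by rewrite -[_ \in _]negbK -black_rot zx.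
by rewrite -{1}zx cross_rot ends_cross // zx -(region_rot zB) zx.
Qed.

Lemma vert_gt0 : 0 < #|vert GB|.
Proof.
have [e _] := card_gt0P (crossing_gt0); have [x _] := crossP e.
by apply/card_gt0P; exists (region x).
Qed.

(* [cut C X] is the state in which the crossings in [C] are contracted and those
   in [X] deleted in the black graph. *)
Definition cut (C X : {set crossing D}) : {set dart D} :=
  [set x | cross x \in if x \in black B then X else C].

Lemma in_cut C X x :
  (x \in cut C X) = (cross x \in if x \in black B then X else C).
Proof. exact: in_set. Qed.

Lemma remaining_cut C X x : remaining (cut C X) x = (cross x \notin C :|: X).
Proof.
rewrite /remaining /map_remaining; apply/idP/idP => [dis|nCX].
  have := disjointFr dis; move=> {}dis.
  have:= dis x (porbit_id _ _).
  have:= dis (rot D x); rewrite mem_porbit_rot eqxx orbT => /(_ isT).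
  by rewrite !inE black_rot cross_rot; case: (x \in black B) => /= -> ->.
rewrite disjoint_subset; apply/subsetP=> y; rewrite -eq_cross !inE => /eqP->.
by move: nCX; rewrite inE negb_or => /andP[nC nX]; case: ifP.
Qed.

(** Colors alternate around a crossing. *)
Lemma mem_opposite_corners x y :
  (y \in [set x; rot D (rot D x)]) =
  (cross y == cross x) && ((y \in black B) == (x \in black B)).
Proof.
rewrite !inE eq_cross mem_porbit_rot; apply/idP/andP => [|[]].
  by case/orP=> /eqP->; rewrite ?black_rot ?negbK !eqxx ?orbT.
case/or4P=> /eqP->; rewrite ?black_rot ?negbK ?eqxx ?orbT //;
  by case: (_ \in _).
Qed.

Lemma smooth_cut C X x : smooth (cut C X) x =
  if x \in black B then cut C (cross x |: X) else cut (cross x |: C) X.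
Proof.
apply/setP=> y; rewrite in_setU mem_opposite_corners.
by case: ifP => _; rewrite !in_cut;
  case: (y \in black B); rewrite ?in_setU1 ?andbF ?andbT ?orbF // orbC.
Qed.

Lemma black_crossP (e : crossing D) : exists2 x, x \in black B & cross x = e.
Proof.
have [x <-] := crossP e; have [xB|xB] := boolP (x \in black B); first by exists x.
by exists (rot D x); rewrite ?black_rot ?cross_rot.
Qed.

(** Along a strand of the final diagram, the black region beside it stays in one component of [C]:
    arcs and cut black corners preserve it, and a cut white corner passes along a contracted
    edge. *)
Lemma gconnected_cut C X : C :|: X = [set: crossing D] ->
  diagram_connected (cut C X) -> @gconnected GB C.
Proof.
move=> CX conS.
have cutP z : z \in cut C X -> connect (@adjacent GB C) (region z) (region (rot D z)).
  rewrite in_cut; case: ifPn => zB zC; first by rewrite region_rot.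
  by apply: (@connect_ends GB) zC _; apply: ends_cross_white.
have link u v : map_linked (rot D) (arc D) (cut C X) u v ->
    connect (@adjacent GB C) (region u) (region v).
  rewrite /map_linked -[map_remaining _ _ _]/(remaining _ _) remaining_cut CX inE /=.
  case/or3P=> [/eqP->|/andP[uS /eqP->]|/andP[vS /eqP->]].
  - by rewrite region_arc.
  - exact: cutP.
  - by rewrite (@adjacent_connect_sym GB) cutP.
move=> F F'; have [x _ <-] := regionP F; have [y _ <-] := regionP F'.
case/connectP: (conS x y) => p; elim: p x => [|z p IH] x /=.
  by move=> _ ->.
by case/andP=> /link xz /IH{}IH /IH; apply: connect_trans.
Qed.

(** * Boundary loops as orbits of a permutation *)

(** A loop with the black corner of [x] on its left leaves the crossing along [turn A x]: [x] itself
    after a deletion, the opposite strand after a contraction. *)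
Definition turn (A : {set crossing D}) x :=
  if (x \in black B) && (cross x \in A) then rot D (rot D x) else x.

Lemma turnK A : involutive (turn A).
Proof.
move=> x; rewrite /turn; case: (boolP ((x \in black B) && _)) => [|/negPf->//].
by rewrite !black_rot negbK !cross_rot => ->; rewrite rot4.
Qed.

(* For black [x], the loop following the strand [rot x] inwards, with the corner
   of [x] on its left, comes back inwards along [rot (boundary A x)] once the
   crossings in [A] are contracted and the others deleted; white darts keep
   going around their region. *)
Definition boundary A : {perm dart D} :=
  perm (inj_comp (@perm_inj _ (face D)) (inv_inj (turnK A))).

Lemma boundaryE A x : boundary A x = face D (turn A x).
Proof. by rewrite permE. Qed.

Lemma boundary0 : boundary set0 = face D.
Proof. by apply/permP=> x; rewrite boundaryE /turn inE andbF. Qed.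

Lemma boundary_black A x : (boundary A x \in black B) = (x \in black B).
Proof.
by rewrite boundaryE black_face /turn; case: ifP => //; rewrite !black_rot negbK.
Qed.

(** A further contraction composes with the transposition of two black corners, which merges two
    loops or splits one. *)
Lemma boundaryU1 (A : {set crossing D}) x : x \in black B -> cross x \notin A ->
  boundary (cross x |: A) = (tperm x (rot D (rot D x)) * boundary A)%g.
Proof.
move=> xB xA; apply/permP=> y; rewrite permM !boundaryE /turn; congr (face D _).
have xB2 : rot D (rot D x) \in black B by rewrite !black_rot negbK.
case: tpermP => [->|->|/eqP nx /eqP nx2].
- by rewrite xB setU11 !cross_rot (negPf xA) andbF.
- by rewrite xB2 !cross_rot setU11 (negPf xA) andbF rot4.
have [yB|//] := boolP (y \in black B); rewrite in_setU1 /=.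
have := mem_opposite_corners x y; rewrite !inE (negPf nx) (negPf nx2) xB yB andbT.
by move=> /= <-.
Qed.

Lemma connect_boundary A x y : x \in black B -> y \in porbit (boundary A) x ->
  connect (@adjacent GB A) (region x) (region y).
Proof.
move=> xB /porbitP[i ->].
suff [] : ((boundary A ^+ i)%g x \in black B) /\
  connect (@adjacent GB A) (region x) (region ((boundary A ^+ i)%g x)) by [].
elim: i => [|i [iB IH]]; first by rewrite perm1.
rewrite expgSr permM boundary_black; split=> //.
apply: connect_trans IH _; set z := _ x in iB *.
rewrite boundaryE /turn iB /=; case: ifP => [zA|_]; last by rewrite region_face.
rewrite region_face ?black_rot ?negbK //.
by apply: (@connect_ends GB) zA _; apply: ends_cross.
Qed.

Lemma porbit_tperm_merge (s : {perm dart D}) x y : x \notin porbit s y ->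
  forall z w, w \in porbit s z -> w \in porbit (tperm x y * s)%g z.
Proof.
move=> nxy; set t := (tperm x y * s)%g.
have xy : x != y by apply: contraNneq nxy => ->; apply: porbit_id.
have txy : porbit t x = porbit t y.
  (* Otherwise [t] has one orbit fewer than [s] and, the same transposition leading back from [t] to
     [s], [s] has one fewer than [t]. *)
  apply/eqP; rewrite eq_porbit_mem; apply/idPn=> ntxy.
  have := porbits_mul_tperm s x y; have := porbits_mul_tperm t x y.
  rewrite /= mulgA tperm2 mul1g -/t ntxy nxy xy; lia.
have step z : porbit t (s z) = porbit t z.
  have ts u : porbit t (t u) = porbit t u.
    by rewrite -[t u]/((t ^+ 1)%g u) porbit_perm.
  have -> : s z = t (tperm x y z) by rewrite permM tpermK.
  by rewrite ts; case: tpermP => [->|->|].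
move=> z _ /porbitP[i ->]; rewrite -eq_porbit_mem; apply/eqP.
by elim: i => [|i IH]; rewrite ?perm1 // expgSr permM step.
Qed.

(** The next edge of a forest joins different components, so by [connect_boundary] its two black
    corners are on different loops; the transposition merges these and splits none. *)
Lemma boundary_forest (A : {set edge GB}) : forest A ->
  (forall x y, x \in black B -> y \in black B -> region x = region y ->
     y \in porbit (boundary A) x) /\
  (forall x, x \in black B -> cross x \in A ->
     rot D (rot D x) \in porbit (boundary A) x).
Proof.
have [n] := ubnP #|A|; elim: n A => // n IH A lt fA.
have [->|[e eA]] := set_0Vmem A.
  split=> [x y xB yB /eqP|x _]; last by rewrite inE.
  by rewrite boundary0 eq_region // porbit_sym.
have [x xB ex] := black_crossP e.
rewrite -{}ex in eA; set A' := A :\ (cross x : edge GB).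
have xA' : cross x \notin A' by rewrite !inE eqxx.
have AE : A = cross x |: A' by rewrite setD1K.
move: fA; rewrite AE (forestU1 xA' (ends_cross xB)) => /andP[fA' nconn].
have [|regA' crossA'] := IH A' _ fA'.
  by move: lt; rewrite (cardsD1 (cross x : edge GB)) eA.
have nx : x \notin porbit (boundary A') (rot D (rot D x)).
  by rewrite porbit_sym; apply: contraNN nconn; apply: connect_boundary.
have merge := porbit_tperm_merge nx.
have xE : rot D (rot D x) \in porbit (boundary (cross x |: A')) x.
  rewrite boundaryU1 //; have := porbits_mul_tperm (boundary A') x (rot D (rot D x)).
  have := porbits_mul_tperm (boundary (cross x |: A')) x (rot D (rot D x)).
  rewrite /= (boundaryU1 xB xA') mulgA tperm2 mul1g nx porbit_sym.
  by case: (_ \in porbit _ _) => //; case: eqP => [->|]; lia.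
split=> [y z yB zB yz|y yB]; first by rewrite boundaryU1 //; apply/merge/regA'.
case/setU1P=> [yx|yA']; last by rewrite boundaryU1 //; apply/merge/crossA'.
have : y \in [set x; rot D (rot D x)] by rewrite mem_opposite_corners yx yB xB !eqxx.
by rewrite !inE => /orP[]/eqP->; rewrite ?rot4 // porbit_sym.
Qed.

(** All black darts lie on one orbit of [s], because [A] connects all black regions. Hence all white
    darts, of the form [rot D x] with [x] black, are linked; an arc leads from each black dart to a
    white one. *)
Lemma connected_cut_basis (A : {set edge GB}) :
  basis A -> diagram_connected (cut A (~: A)).
Proof.
move=> bA; have [regA crossA] := boundary_forest (basis_forest bA).
set S := cut A (~: A); set s := boundary A.
have symS : connect_sym (map_linked (rot D) (arc D) S).
  apply: sym_connect_sym => x y; rewrite /map_linked.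
  rewrite -![map_remaining _ _ _]/(remaining _ _).
  rewrite !remaining_cut setUCr !inE orbC /= orbC; congr (_ || _); last by rewrite orbC.
  by rewrite eq_sym (inv_eq (@arc_involutive D)).
have cutP z : z \in S -> connect (map_linked (rot D) (arc D) S) z (rot D z).
  move=> zS; apply: connect1; rewrite /map_linked -[map_remaining _ _ _]/(remaining _ _).
  by rewrite remaining_cut setUCr in_setT /= zS eqxx orbT.
have arcP z : connect (map_linked (rot D) (arc D) S) z (arc D z).
  by apply: connect1; rewrite /map_linked eqxx.
(* [rot D x] is joined to [turn A x], across the white corner [rot D x] after a contraction and
   across the black corner [x] after a deletion; the arc from there ends at [rot D (s x)]. *)
have step x : x \in black B ->
    connect (map_linked (rot D) (arc D) S) (rot D x) (rot D (s x)).
  move=> xB; rewrite boundaryE -arcE; apply: connect_trans (arcP _); rewrite /turn xB /=.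
  case: ifPn => xA; first by apply: cutP; rewrite in_cut black_rot xB cross_rot.
  by rewrite symS; apply: cutP; rewrite in_cut xB inE.
have orbS x y : x \in black B -> y \in porbit s x ->
    connect (map_linked (rot D) (arc D) S) (rot D x) (rot D y).
  move=> xB /porbitP[i ->].
  suff [] : ((s ^+ i)%g x \in black B) /\
    connect (map_linked (rot D) (arc D) S) (rot D x) (rot D ((s ^+ i)%g x)) by [].
  elim: i => [|i [iB IH]]; first by rewrite perm1.
  rewrite expgSr permM boundary_black; split=> //.
  exact: connect_trans IH (step _ iB).
have region_s x y : x \in black B -> y \in black B -> region x = region y ->
    porbit s x = porbit s y.
  by move=> xB yB xy; apply/eqP; rewrite eq_porbit_mem porbit_sym regA.
have adj_s x y : x \in black B -> y \in black B ->
    @adjacent GB A (region x) (region y) -> porbit s y = porbit s x.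
  move=> xB yB /exists_inP[e eA /eqP ende]; have [z zB ez] := black_crossP e.
  have z2B : rot D (rot D z) \in black B by rewrite !black_rot negbK.
  rewrite -ez in eA ende; have zz := crossA z zB eA.
  rewrite -eq_porbit_mem -/s in zz; have [xe ye] :
      region x \in [set region z; region (rot D (rot D z))] /\
      region y \in [set region z; region (rot D (rot D z))].
    by rewrite -ends_cross // ende !inE !eqxx orbT.
  move: xe ye; rewrite !inE.
  by do 2![case/orP => /eqP/region_s->//]; rewrite ?(eqP zz).
have all_s x y : x \in black B -> y \in black B -> porbit s y = porbit s x.
  move=> xB yB; case/connectP: (basis_gconnected bA (region x) (region y)) => p.
  elim: p x xB => [|F p IH] x xB /= => [_ xy|]; first exact: region_s.
  have [z zB <-] := regionP F => /andP[/(adj_s _ _ xB zB) <-].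
  exact: IH.
have all_white x y : x \notin black B -> y \notin black B ->
    connect (map_linked (rot D) (arc D) S) x y.
  have rotV z : z \notin black B -> exists2 z', z' \in black B & z = rot D z'.
    move=> zB; exists ((rot D)^-1%g z); rewrite ?permKV //.
    by rewrite -[_ \in _]negbK -black_rot permKV.
  move=> /rotV[x' xB ->] /rotV[y' yB ->]; apply: orbS => //.
  by rewrite -eq_porbit_mem (all_s x').
have to_white x : exists2 x', x' \notin black B &
    connect (map_linked (rot D) (arc D) S) x x'.
  have [xB|xB] := boolP (x \in black B); last by exists x.
  by exists (arc D x); rewrite ?black_arc ?xB.
move=> x y; have [x' xB xx'] := to_white x; have [y' yB yy'] := to_white y.
apply: connect_trans xx' (connect_trans (all_white _ _ xB yB) _).
by rewrite symS.
Qed.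

End Colored.

(** * The two strategies *)

Section TwoColors.
Variable B : coloring D.
Local Notation GB := (black_graph B).

Lemma black_recolor x : (x \in black (recolor B)) = (x \notin black B).
Proof. exact: in_setC. Qed.

Lemma cut_recolor C X : cut (recolor B) X C = cut B C X.
Proof.
by apply/setP=> x; rewrite !in_cut black_recolor; case: (x \in black B).
Qed.

Lemma card_regions :
  #|black_region B| + #|black_region (recolor B)| = #|porbits (face D)|.
Proof.
rewrite !card_sig.
rewrite -(cardID [pred F : {set dart D} | F \subset black B] (mem (porbits (face D)))).
congr (_ + _); apply: eq_card => F; rewrite !inE /= ?andbT //.
rewrite andbC; case FP: (F \in _); rewrite ?andbF ?andbT //=.
case/imsetP: FP => x _ ->.
have orbB y : y \in porbit (face D) x -> (y \in black B) = (x \in black B).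
  case/porbitP=> i ->; elim: i => [|i IH]; first by rewrite perm1.
  by rewrite expgSr permM black_face.
apply/idP/idP => [/subsetP sub|nB].
  apply/negP=> /subsetP/(_ x (porbit_id _ _)) xB.
  by have := sub x (porbit_id _ _); rewrite inE xB.
have xB : x \notin black B.
  by apply: contra nB => xB; apply/subsetP=> y /orbB->.
by apply/subsetP=> y /orbB; rewrite inE => ->.
Qed.

(** * Knot moving second *)

Lemma knot_wins_second (T1 T2 : {set edge GB}) :
  basis T1 -> basis T2 -> T1 :&: T2 = set0 -> T1 :|: T2 = [set: edge GB] ->
  can_win Knot Link (set0 : {set dart D}).
Proof.
move=> b1 b2 I12 U12.
pose I S := exists A1 A2 : {set edge GB},
  [/\ basis A1, basis A2 & S = cut B (A1 :&: A2) (~: (A1 :|: A2))].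
rewrite -[Link]/(opponent Knot); apply: (@second_wins Knot I) => [S|S x|].
- case=> A1 [A2 [bA1 bA2 ->]] rem; rewrite /=.
  suff eA : A1 = A2 by rewrite eA setIid setUid; apply: connected_cut_basis.
  apply/setP=> e; have [x xe] := crossP e; have := rem x.
  by rewrite remaining_cut xe negbK !inE; do 2!case: (e \in _).
- case=> A1 [A2 [bA1 bA2 ->]]; rewrite remaining_cut => xr.
  (* Up to exchanging the bases, Link's crossing lies only in the first one. *)
  have {xr bA1 bA2} [A [A' [bA bA' xA -> ->]]] : exists A A' : {set edge GB},
      [/\ basis A, basis A', (cross x : edge GB) \in A :\: A',
          A1 :&: A2 = A :&: A' & A1 :|: A2 = A :|: A'].
    move: xr; rewrite !inE negb_or negbK => /andP[nI /orP[x1|x2]].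
      by exists A1, A2; split; rewrite // !inE x1 andbT; move: nI; rewrite x1.
    exists A2, A1; split; rewrite 1?setIC 1?setUC // !inE x2 andbT.
    by move: nI; rewrite x2 andbT.
  case: (boolP (x \in black B)) => xB; rewrite smooth_cut ?xB ?(negPf xB).
    (* Link deletes: [f] replaces the crossing in [A], thus lies in both bases, and is contracted at
       a white corner. *)
    have [f fA bf] := basis_exchangeD bA bA' xA.
    have [y0 yB yf] := black_crossP (recolor B) f.
    have {}yB : y0 \notin black B by rewrite black_recolor in yB.
    exists y0.
      rewrite remaining_cut yf; move: fA xA => /setDP[f2 f1] /setDP[x1 x2].
      by rewrite !inE (negPf f1) f2 orbF /=; apply: contraNneq f1 => ->.
    rewrite smooth_cut (negPf yB) yf.
    exists (f |: A :\ (cross x : edge GB)), A'; split=> //.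
    move: fA xA => /setDP[f2 f1] /setDP[x1 x2].
    have fx : f != cross x by apply: contraNneq f1 => ->.
    congr cut; apply/setP=> g; rewrite !inE.
      case: (eqVneq g f) => [->|_]; first by rewrite fx f2.
      by case: (eqVneq g (cross x)) => [->|_]; rewrite ?(negPf x2) ?andbF.
    case: (eqVneq g f) => [->|_]; first by rewrite f2 orbT (negPf fx).
    by case: (eqVneq g (cross x)) => [->|_]; rewrite ?(negPf x2).
  (* Link contracts: the crossing replaces [f] in [A']; now in neither basis, [f] is deleted. *)
  have [f fA bf] := basis_exchangeU bA bA' xA.
  have [y yB yf] := black_crossP B f; exists y.
    rewrite remaining_cut yf; move: fA xA => /setDP[f2 f1] /setDP[x1 x2].
    by rewrite !inE (negPf f1) f2 orbF orbF; apply: contraNneq f1 => ->.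
  rewrite smooth_cut yB yf; exists A, ((cross x : edge GB) |: A' :\ f); split=> //.
  move: fA xA => /setDP[f2 f1] /setDP[x1 x2].
  have fx : f != cross x by apply: contraNneq f1 => ->.
  congr cut; apply/setP=> g; rewrite !inE.
    case: (eqVneq g (cross x)) => [->|_]; first by rewrite x1.
    by case: (eqVneq g f) => [->|_]; rewrite ?(negPf f1) ?andbF.
  case: (eqVneq g f) => [->|_]; first by rewrite (negPf f1) (negPf fx).
  by case: (eqVneq g (cross x)) => [->|_]; rewrite ?x1.
exists T1, T2; split=> //; rewrite I12 U12 setCT.
by apply/setP=> x; rewrite in_cut if_same !inE.
Qed.

(** * Link moving second *)

Lemma link_wins_second : #|crossing D|.+2 = (#|vert GB|).*2 ->
  can_win Link Knot (set0 : {set dart D}).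
Proof.
have [n nV] : exists n, #|vert GB| = n by exists #|vert GB|.
rewrite nV => cE.
have nE : #|vert (black_graph (recolor B))| = n.
  have := planar D; rewrite card_crossing_arcs -[map_face _ _]/(face D) -card_regions.
  have -> : #|porbits (rot D)| = #|crossing D| by rewrite card_sig; apply: eq_card.
  by move: nV cE => /= ->; lia.
(* Contractions and deletions are equally many exactly as long as crossings remain. *)
pose I S := exists C X : {set crossing D}, [/\ S = cut B C X, C :&: X = set0
  & (#|C| == #|X|) = (C :|: X != [set: crossing D])].
rewrite -[Knot]/(opponent Link).
apply: (@second_wins Link I)
  => [S [C [X [-> dis cCX]]] rem|S x [C [X [-> dis cCX]]]|].
- have CX : C :|: X = [set: crossing D].
    apply/setP=> e; rewrite in_setT; have [x <-] := crossP e.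
    by have := rem x; rewrite remaining_cut negbK.
  (* Connectedness requires [n - 1] edges in each of [C] and [X]; the total [2n - 2] would make them
     equally many. *)
  move=> conS; have cC : n <= #|C|.+1.
    by rewrite -nV; apply: card_gconnected (vert_gt0 B) (gconnected_cut CX conS).
  have cX : n <= #|X|.+1.
    rewrite -nE; apply: card_gconnected (vert_gt0 _) _.
    by apply: (@gconnected_cut (recolor B) X C); rewrite ?cut_recolor // setUC.
  have cS : #|C| + #|X| = #|crossing D| by rewrite -cardsUI dis cards0 addn0 CX cardsT.
  have /eqP ne : #|C| != #|X| by rewrite cCX CX eqxx.
  by apply: ne; lia.
- rewrite remaining_cut => xr.
  have neqT : C :|: X != [set: crossing D] by apply: contraNneq xr => ->; rewrite inE.
  have /eqP cc : #|C| == #|X| by rewrite cCX.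
  have cU : #|C :|: X| = #|C| + #|X| by rewrite -cardsUI dis cards0 addn0.
  set U := cross x |: (C :|: X).
  have cU' : #|U| = (#|C| + #|X|).+1 by rewrite cardsU1 xr cU.
  (* [U] has odd cardinality and the number of crossings is even, so a reply is available. *)
  have /subsetPn[e _ eU] : ~~ ([set: crossing D] \subset U).
    apply/negP=> /subset_leq_card; rewrite cardsT cU'.
    have: #|U| <= #|crossing D| by exact: max_card.
    by rewrite cU'; lia.
  pose last := e |: U == [set: crossing D].
  have xC : cross x \notin C by apply: contra xr => xC; rewrite inE xC.
  have xX : cross x \notin X by apply: contra xr => xX; rewrite inE xX orbT.
  have eC : e \notin C by apply: contra eU => eC; rewrite !inE eC orbT.
  have eX : e \notin X by apply: contra eU => eX; rewrite !inE eX !orbT.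
  have ex : e != cross x by apply: contraNneq eU => ->; rewrite !inE eqxx.
  (* Corners of the same color give the same kind of smoothing: Knot's move is copied in the last
     round only. *)
  have [y yB ye] : exists2 y,
      (y \in black B) = ((x \in black B) == last) & cross y = e.
    case: (_ == last); first by have [y ? ?] := black_crossP B e; exists y.
    have [y yB ye] := black_crossP (recolor B) e; exists y => //.
    by rewrite black_recolor in yB; apply: negPf.
  have goalI (C' X' : {set crossing D}) : C' :|: X' = e |: U -> C' :&: X' = set0 ->
      (#|C'| == #|X'|) = ~~ last -> I (cut B C' X').
    by move=> U' I' cCX'; exists C', X'; split; rewrite // U'.
  exists y.
    by rewrite smooth_cut; case: ifP => _; rewrite remaining_cut ye ?(setUCA C) -?setUA.
  (* These incompatible memberships settle the disjointness of the new sets element by element. *)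
  have eqz (z : crossing D) : [/\ (z \in C) && (z \in X) = false,
      (z == e) && [|| z == cross x, z \in C | z \in X] = false
      & (z == cross x) && ((z \in C) || (z \in X)) = false].
    split; first by have /setP/(_ z) := dis; rewrite !inE.
      by case: eqVneq => // ->; rewrite (negPf ex) (negPf eC) (negPf eX).
    by case: eqVneq => // ->; rewrite (negPf xC) (negPf xX).
  rewrite smooth_cut; case xB: (x \in black B) yB; rewrite smooth_cut ye => ->;
    case lst: (_ == last); (apply: goalI;
      [ by apply/setP=> z; rewrite !inE; do !case: (_ \in _); do !case: (_ == _)
      | apply/setP=> z; rewrite !inE; case: (eqz z);
        by case: (z == e); case: (z == cross x); case: (z \in C); case: (z \in X)
      | rewrite !cardsU1 ?inE ?(negPf ex) ?eC ?eX ?xC ?xX cc;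
        by move: lst; case: (last) => // _; lia]).
exists set0, set0; split; first by apply/setP=> x; rewrite in_cut if_same !inE.
  by rewrite set0I.
rewrite set0U eqxx eq_sym -subset0; apply/esym/subsetPn.
by have [e _] := card_gt0P crossing_gt0; exists e; rewrite ?inE.
Qed.

End TwoColors.
End Shadow.

Theorem theorem8 (D : shadow) (B : coloring D)
    (T1 T2 : {set edge (black_graph B)}) :
  @gconnected (black_graph B) [set: edge (black_graph B)] ->
  spanning_tree T1 -> spanning_tree T2 ->
  T1 :&: T2 = set0 -> T1 :|: T2 = [set: edge (black_graph B)] ->
  P_position D.
Proof.
move=> _ /(spanning_tree_basis (vert_gt0 B)) b1.
move=> /(spanning_tree_basis (vert_gt0 B)) b2 I12 U12 [].
  exact: knot_wins_second b1 b2 I12 U12.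
apply: (link_wins_second (B := B)).
have cT : #|T1| + #|T2| = #|crossing D|.
  by rewrite -cardsUI I12 cards0 addn0 U12 cardsT.
case/andP: b1 b2 => _ /eqP v1 /andP[_ /eqP v2].
by rewrite -cT -addnn -{1}v1 -v2 addSn addnS.
Qed.
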